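(* Let $q$ be a power of an odd prime $p$, let $n=2^{e_0}p_1^{e_1}\cdots p_s^{e_s}$, where $p_1,\dots,p_s$ are distinct odd primes different from $p$ and $e_0,e_1,\dots,e_s$ are positive integers, let $n'=p_1^{e_1}\cdots p_s^{e_s}$, and let $\eta$ be a primitive root system modulo $n'$. (1) Let $(y,x)\in\Sigma^+(n';q)$. For any $d\in\{0,1,\dots,e_0\}$ and $t\in\{0,1\}^{s_{y,d}^+}$, the size of the coset $c_{n/q}(\mu(y,x)_{d,t}^+)$ is $$|c_{n/q}(\mu(y,x)_{d,t}^+)|=2^{\max\{e_0-d-v^+(y),0\}}\cdot\omega_yp_1^{M_{y_1}}\cdots p_s^{M_{y_s}}.$$ (2) Let $(y,x)\in\Sigma^-(n';q)$. For any $d\in\{0,1,\dots,e_0\}$ and $t\in\{0,1\}^{s_{y,d}^-}$, the size of the coset $c_{n/q}(\mu(y,x)_{d,t}^-)$ is $$|c_{n/q}(\mu(y,x)_{d,t}^-)|=\begin{cases}2^{\max\{e_0-d-v^-(y),1\}}\cdot\omega_yp_1^{M_{y_1}}\cdots p_s^{M_{y_s}},&0\le d\le e_0-2;\\\omega_yp_1^{M_{y_1}}\cdots p_s^{M_{y_s}},&d=e_0-1\text{ or }e_0.\end{cases}$$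
   Context: For $N\ge1$ coprime to $q$, the $q$-cyclotomic coset modulo $N$ containing an integer $\gamma$ is $c_{N/q}(\gamma)=\{\gamma q^j\bmod N:j\ge0\}\subseteq\mathbb{Z}/N\mathbb{Z}$. $v_\ell$ is the $\ell$-adic valuation; $\mathrm{ord}_1(q)=1$. An $s$-tuple $\eta=(\eta_1,\dots,\eta_s)$ of integers is a primitive root system modulo $n'=p_1^{e_1}\cdots p_s^{e_s}$ if for every $i$: $\eta_i$ is a primitive root modulo $p_i^{d}$ for all $d\ge1$, and $\eta_i\equiv1\pmod{p_j^{e_j}}$ for every $j\ne i$. For $0\le y_i\le e_i$ put $f_{i,y_i}=\mathrm{ord}_{p_i^{e_i-y_i}}(q)$, $g_{i,y_i}=\phi(p_i^{e_i-y_i})/f_{i,y_i}$. $\Sigma(n';q)$ is the set of $2s$-tuples of integers $(y,x)=(y_1,\dots,y_s,x_1,\dots,x_s)$ with $0\le y_i\le e_i$ and $0\le x_i\le g_{i,y_i}\gcd(\mathrm{lcm}(f_{1,y_1},\dots,f_{i-1,y_{i-1}}),f_{i,y_i})-1$ for all $i$ (for $i=1$ the gcd is understood to be $1$). $\eta^{(y,x)}=\eta_1^{x_1}\cdots\eta_s^{x_s}p_1^{y_1}\cdots p_s^{y_s}$; $\tau_y=\mathrm{lcm}(f_{1,y_1},\dots,f_{s,y_s})$; $m_{y_i}=\min\{e_i-y_i,1\}$; $\omega_y=\mathrm{lcm}(\mathrm{ord}_{p_1^{m_{y_1}}}(q),\dots,\mathrm{ord}_{p_s^{m_{y_s}}}(q))$;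 $M_{y_i}=\max\{e_i-y_i-v_{p_i}(q^{\omega_y}-1),0\}$. $\Sigma^+(n';q)$ (resp. $\Sigma^-(n';q)$) is the set of $(y,x)\in\Sigma(n';q)$ with $q^{\tau_y}\equiv1$ (resp. $3$) $\pmod4$. For an integer $\gamma$, $\varphi_{n'}(\gamma)=\sum_{k\ge0}\phi_{n',k}(\gamma)2^k$, $\phi_{n',k}(\gamma)\in\{0,1\}$, is the unique formal $2$-adic power series with $2^{i+1}\mid\gamma+n'\sum_{k=0}^i\phi_{n',k}(\gamma)2^k$ for all $i\ge0$; and for $d\ge0$, $U_d(\gamma)=\sum_{k=0}^{d-1}\phi_{n',k}(\gamma)2^k+(1-\phi_{n',d}(\gamma))2^d$. For $(y,x)\in\Sigma^+(n';q)$ and $0\le d\le e_0$: $v^+(y)=v_2(q^{\tau_y}-1)$, $s_{y,d}^+=\min\{e_0-d-1,v^+(y)-1\}$, and for $t\in\{0,1\}^{s_{y,d}^+}$, $\mu(y,x)_{d,t}^+=\eta^{(y,x)}+n'(U_d(\eta^{(y,x)})+\sum_{j=1}^{s_{y,d}^+}t_j2^{d+j})$. For $(y,x)\in\Sigma^-(n';q)$ and $0\le d\le e_0$: $v^-(y)=v_2(q^{\tau_y}+1)$, $s_{y,d}^-=\min\{e_0-d-2,v^-(y)-1\}$, and for $t\in\{0,1\}^{s_{y,d}^-}$, $\mu(y,x)_{d,t}^-=\eta^{(y,x)}+n'(U_d(\eta^{(y,x)})+\sum_{j=1}^{s_{y,d}^-}t_j2^{d+j+1})$. When $s_{y,d}^{\pm}\le0$,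 $\{0,1\}^{s_{y,d}^\pm}$ is the one-element set $\{0\}$ and the sum over $j$ is empty. *)

(* Defs.v *)
From mathcomp Require Import all_boot all_order all_fingroup all_algebra.
From mathcomp Require Import zify boolp classical_sets.

Set Implicit Arguments.
Unset Strict Implicit.
Unset Printing Implicit Defensive.

Import Order.TTheory GRing.Theory Num.Theory.

(* ord_N(a) for a coprime to N >= 1.  Since 'Z_1 is Z/2, whose unit group is
   trivial, this gives ord_1(a) = 1 as required. *)
Definition ordmod (N : nat) (a : int) : nat :=
  #[insubd (1%g : {unit 'Z_N}) (a%:~R%R : 'Z_N)]%g.

Definition primitive_root (N : nat) (a : int) : Prop :=
  coprimez a N /\ ordmod N a = totient N.

(* c_{N/q}(gamma), with Z/N represented by 'I_N. *)
Definition cyclotomic_coset (N q : nat) (gamma : int) : {set 'I_N} :=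
  [set x : 'I_N |
    `[< exists j : nat, (x : nat)%:Z = (gamma * q%:Z ^+ j %% N)%Z :> int >]]%R.

Definition primitive_root_system (s : nat) (p e : 'I_s -> nat)
    (eta : 'I_s -> int) : Prop :=
  forall i : 'I_s,
    (forall d : nat, 0 < d -> primitive_root (p i ^ d) (eta i)) /\
    (forall j : 'I_s, j != i -> (eta i = 1 %[mod (p j ^ e j)%N])%Z).

Definition oddpart (s : nat) (p e : 'I_s -> nat) : nat :=
  \prod_(i < s) p i ^ e i.

Section CosetData.

Context (q s : nat) (p e : 'I_s -> nat).

Definition ford (y : 'I_s -> nat) (i : 'I_s) : nat :=
  ordmod (p i ^ (e i - y i)) q.

Definition gind (y : 'I_s -> nat) (i : 'I_s) : nat :=
  totient (p i ^ (e i - y i)) %/ ford y i.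

(* For the first index the lcm is empty, hence 1, and so is the gcd. *)
Definition Sigma (y x : 'I_s -> nat) : Prop :=
  forall i : 'I_s,
    y i <= e i /\
    x i <= gind y i *
           gcdn (\big[lcmn/1]_(j < s | j < i) ford y j) (ford y i) - 1.

Definition tau (y : 'I_s -> nat) : nat := \big[lcmn/1]_(i < s) ford y i.

Definition omega (y : 'I_s -> nat) : nat :=
  \big[lcmn/1]_(i < s) ordmod (p i ^ minn (e i - y i) 1) q.

(* Truncated subtraction is the maximum with 0. *)
Definition Mexp (y : 'I_s -> nat) (i : 'I_s) : nat :=
  e i - y i - logn (p i) (q ^ omega y - 1).

Definition Sigma_plus (y x : 'I_s -> nat) : Prop :=
  Sigma y x /\ q ^ tau y = 1 %[mod 4].

Definition Sigma_minus (y x : 'I_s -> nat) : Prop :=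
  Sigma y x /\ q ^ tau y = 3 %[mod 4].

Definition v_plus (y : 'I_s -> nat) : nat := logn 2 (q ^ tau y - 1).

Definition v_minus (y : 'I_s -> nat) : nat := logn 2 (q ^ tau y + 1).

(* Truncated subtraction turns a negative value into 0; this is harmless, as
   {0,1}^s is a one-element set and the sum over j is empty whenever s <= 0. *)
Definition s_plus (e0 : nat) (y : 'I_s -> nat) (d : nat) : nat :=
  minn (e0 - d - 1) (v_plus y - 1).

Definition s_minus (e0 : nat) (y : 'I_s -> nat) (d : nat) : nat :=
  minn (e0 - d - 2) (v_minus y - 1).

End CosetData.

Definition eta_yx (s : nat) (p : 'I_s -> nat) (eta : 'I_s -> int)
    (y x : 'I_s -> nat) : int :=
  ((\prod_(i < s) eta i ^+ x i) * \prod_(i < s) (p i)%:Z ^+ y i)%R.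

Definition two_adic_expansion (n' : nat) (gamma : int) (b : nat -> bool) : Prop :=
  forall i : nat,
    (2 ^+ i.+1 %| gamma + n'%:Z * (\sum_(k < i.+1) b k * 2 ^ k)%N%:Z)%Z%R.

Lemma two_adic_expansion_exists_unique (n' : nat) (gamma : int) :
  odd n' -> exists! b, two_adic_expansion n' gamma b.
Proof.
move=> on.
have step (c : int) (i : nat) : (2 ^+ i %| c)%Z%R ->
    exists b : bool, forall b' : bool,
    (2 ^+ i.+1 %| c + n'%:Z * (b' * 2 ^ i)%N%:Z)%Z%R = (b' == b).
  case/dvdzP=> m ->; exists (odd `|m|) => b'.
  have -> : (m * 2 ^+ i + n'%:Z * (b' * 2 ^ i)%N%:Z = (m + (n' * b')%N%:Z) * 2 ^+ i)%R.
    by rewrite mulrDl !PoszM mulrA -[Posz (2 ^ i)]natz natrX.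
  rewrite exprS dvdz_mul2r ?expf_neq0 //.
  apply/idP/eqP; case: b'; rewrite ?muln1 ?muln0; lia.
have key (F : nat -> bool) i :
    (\sum_(k < i.+1) F k * 2 ^ k)%N = (\sum_(k < i) F k * 2 ^ k + F i * 2 ^ i)%N.
  by rewrite big_ord_recr.
pose T := (fun (b : nat -> bool) (i : nat) => gamma + n'%:Z * (\sum_(k < i) b k * 2 ^ k)%N%:Z)%R.
have TS b i : T b i.+1 = (T b i + n'%:Z * (b i * 2 ^ i)%N%:Z)%R.
  by rewrite /T key PoszD mulrDr addrA.
have ex : exists b, forall i, (2 ^+ i %| T b i)%Z%R.
  pose S := fix S i : nat := if i is j.+1 then
    (S j + (~~ (2 ^+ j.+1 %| gamma + n'%:Z * (S j)%:Z)%Z%R) * 2 ^ j)%N else 0%N.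
  pose b i := ~~ (2 ^+ i.+1 %| gamma + n'%:Z * (S i)%:Z)%Z%R.
  have SE i : S i = (\sum_(k < i) b k * 2 ^ k)%N.
    by elim: i => [|i IH]; [rewrite big_ord0 | rewrite key -IH].
  exists b; elim=> [|i IH]; first by rewrite expr0 dvd1z.
  rewrite TS; have [c Hc] := step _ _ IH; rewrite Hc.
  have := Hc false; rewrite mul0n mulr0 addr0 /b SE => ->.
  by case: c {Hc}.
case: ex => b Hb; exists b; split=> [i|b' Hb']; first exact: Hb.
apply/funext => i.
have [m] := ubnP i; elim: m i => // m IH i lim.
have TE : T b' i = T b i.
  rewrite /T; congr (_ + _ * Posz _)%R; apply: eq_bigr => k _.
  by rewrite IH //; apply: leq_trans (ltn_ord k) _.
have [c Hc] := step _ _ (Hb i).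
have := Hb i.+1; have := Hb' i; rewrite -/(T b' i.+1) !TS TE !Hc.
by move=> /eqP-> /eqP->.
Qed.

(* The sequence (phi_{n',k}(gamma))_k, for odd n'. *)
Definition phi_bits (n' : nat) (gamma : int) : nat -> bool :=
  xget (fun=> false) (two_adic_expansion n' gamma).

Definition Ubits (n' : nat) (gamma : int) (d : nat) : nat :=
  (\sum_(k < d) phi_bits n' gamma k * 2 ^ k) + (1 - phi_bits n' gamma d) * 2 ^ d.

(* The components t_1, ..., t_s of t are stored at positions 0, ..., s - 1. *)
Definition mu_plus (q e0 s : nat) (p e : 'I_s -> nat) (eta : 'I_s -> int)
    (y x : 'I_s -> nat) (d : nat) (t : (s_plus q p e e0 y d).-tuple bool) : int :=
  let n' := oddpart p e in
  let g := eta_yx p eta y x in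
  (g + n'%:Z * (Ubits n' g d +
     \sum_(j < s_plus q p e e0 y d) tnth t j * 2 ^ (d + j.+1))%N%:Z)%R.

Definition mu_minus (q e0 s : nat) (p e : 'I_s -> nat) (eta : 'I_s -> int)
    (y x : 'I_s -> nat) (d : nat) (t : (s_minus q p e e0 y d).-tuple bool) : int :=
  let n' := oddpart p e in
  let g := eta_yx p eta y x in
  (g + n'%:Z * (Ubits n' g d +
     \sum_(j < s_minus q p e e0 y d) tnth t j * 2 ^ (d + j.+1 + 1))%N%:Z)%R.

(* Main.v *)
Require Import Defs.
From mathcomp Require Import all_boot all_order all_fingroup all_algebra.
From mathcomp Require Import cyclic zify ring boolp classical_sets.

(* The size of the coset of mu is the least j > 0 such that n divides
   mu (q^j - 1). Modulo p_i^{e_i}, mu is p_i^{y_i} times a unit, and U_d flips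
   the d-th 2-adic digit of the solution z of gamma + n' z = 0, so that
   v_2(mu) = d. Hence the condition reads: tau_y divides j and 2^{e_0-d} divides
   q^j - 1. Lifting the exponent at the odd primes p_i, from q^{omega_y} = 1
   mod p_i, gives tau_y = omega_y prod p_i^{M_i}; lifting the exponent at 2 for
   q^{tau_y} gives the power of 2. When q^{tau_y} = 3 mod 4 one first has to
   square, and v_2(q^{2 tau_y} - 1) = 1 + v_2(q^{tau_y} + 1). *)

Set Implicit Arguments.
Unset Strict Implicit.
Unset Printing Implicit Defensive.

Import GRing.Theory.

(** * Lifting the exponent at odd primes and at 2 *)

(** Expand each (1+u)^i to first order in u; the linear coefficients i add up to 'C(k, 2). For u = Q
    - 1 the sum is (Q^k - 1)/(Q - 1), whose valuation is needed below. *)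
Lemma geometric_sum_mod_sq (u k : nat) :
  exists c, \sum_(i < k) u.+1 ^ i = k + u * 'C(k, 2) + c * u ^ 2.
Proof.
elim: k => [|k [c IH]]; first by exists 0; rewrite big_ord0 muln0.
exists ('C(k, 2) + c * u.+1); rewrite big_ord_recl expn0.
under eq_bigr => i _ do rewrite lift0 expnS.
rewrite -big_distrr IH /= binS bin1 !expnS expn0; ring.
Qed.

(* The last hypothesis covers odd p (then p divides 'C(p, 2)) as well as p = 2
   with Q = 1 mod 4. *)
Lemma lifting_exponent (p Q k : nat) : prime p -> 1 < Q -> 0 < k ->
  p %| Q - 1 -> p ^ 2 %| (Q - 1) * 'C(p, 2) ->
  logn p (Q ^ k - 1) = logn p (Q - 1) + logn p k.
Proof.
move=> pp; have p1 := prime_gt1 pp; have p0 := prime_gt0 pp.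
(* Strong induction on [k] with [Q] free: a factor p of k moves into the base, as Q^(pl) =
   (Q^p)^l. *)
have [m] := ubnP k; elim: m k Q => // m IH k Q lekm Q1 k0 pQ pQ2.
have QE : Q = (Q - 1).+1 by rewrite subn1 prednK // ltnW.
set u := Q - 1 in pQ pQ2 QE *; have u0 : 0 < u by rewrite subn_gt0.
have sum0 l : 0 < l -> 0 < \sum_(i < l) Q ^ i.
  by case: l => // l _; rewrite big_ord_recl addn_gt0.
have factor l : Q ^ l - 1 = u * \sum_(i < l) Q ^ i.
  by rewrite !subn1 predn_exp -subn1.
have [/dvdnP[l kE]|pNk] := boolP (p %| k); last first.
  (* The geometric sum is congruent to k modulo p, hence prime to p. *)
  rewrite factor lognM ?sum0 //; congr addn.
  rewrite [RHS]logn_coprime ?prime_coprime // logn_coprime //.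
  have [c] := geometric_sum_mod_sq u k; rewrite -QE => ->.
  rewrite prime_coprime // -addnA dvdn_addl //.
  by rewrite dvdn_add ?(dvdn_mulr _ pQ) ?dvdn_mull ?dvdn_exp.
have l0 : 0 < l by move: k0; rewrite kE muln_gt0 => /andP[].
have logp : logn p (Q ^ p - 1) = (logn p u).+1.
  rewrite factor lognM ?sum0 // -addn1; congr addn.
  (* Modulo p^2 the sum is p, since p^2 divides both u 'C(p, 2) and u^2; so it contains exactly one
     factor p. *)
  have [c] := geometric_sum_mod_sq u p; rewrite -QE => SE.
  have S0 := sum0 p p0; apply/eqP; rewrite eqn_leq -ltnS ltnNge.
  rewrite -!pfactor_dvdn // SE expn1.
  have pu2 : p ^ 2 %| u ^ 2 by rewrite dvdn_exp2r.
  rewrite dvdn_addl ?(dvdn_mull _ pu2) // dvdn_addl //.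
  apply/andP; split.
    by apply/negP => /dvdn_leq; rewrite p0 expnS expn1 => /(_ isT); nia.
  rewrite -addnA dvdn_addr // dvdn_add ?(dvdn_mulr _ pQ) //.
  by rewrite dvdn_mull ?dvdn_exp.
have lm : l < m.
  by rewrite -ltnS; apply: leq_trans lekm; rewrite kE ltnS ltn_Pmulr.
have Qp1 : 1 < Q ^ p by rewrite -(exp1n p) ltn_exp2r.
have uQp : u %| Q ^ p - 1 by rewrite factor dvdn_mulr.
have pQ2' : p ^ 2 %| (Q ^ p - 1) * 'C(p, 2).
  exact: dvdn_trans pQ2 (dvdn_mul uQp (dvdnn _)).
rewrite kE mulnC expnM (IH _ _ lm) ?(dvdn_trans pQ uQp) //.
by rewrite logp lognM // (logn_prime _ pp) eqxx; lia.
Qed.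

Lemma dvdn_expn_sub1 (p Q a k : nat) : prime p -> 1 < Q ->
  p %| Q - 1 -> p ^ 2 %| (Q - 1) * 'C(p, 2) ->
  (p ^ a %| Q ^ k - 1) = (p ^ (a - logn p (Q - 1)) %| k).
Proof.
move=> pp Q1 pQ pQ2; case: k => [|k]; first by rewrite expn0 subnn !dvdn0.
rewrite !pfactor_dvdn ?lifting_exponent ?leq_subLR //.
by rewrite subn_gt0 -(exp1n k.+1) ltn_exp2r.
Qed.

Lemma dvdn_expn_sub1_odd (p Q a k : nat) : prime p -> odd p -> 1 < Q ->
  p %| Q - 1 -> (p ^ a %| Q ^ k - 1) = (p ^ (a - logn p (Q - 1)) %| k).
Proof.
move=> pp op Q1 pQ; apply: dvdn_expn_sub1 => //.
have p2 : 2 < p by have := prime_gt1 pp; move: op; case: p {pp pQ} => [|[|[]]].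
by rewrite expnS expn1 dvdn_mul ?prime_dvd_bin.
Qed.

Lemma dvdn_expn_sub1_two (Q a k : nat) : 1 < Q -> 4 %| Q - 1 ->
  (2 ^ a %| Q ^ k - 1) = (2 ^ (a - logn 2 (Q - 1)) %| k).
Proof.
move=> Q1 Q4; apply: dvdn_expn_sub1; rewrite ?muln1 //.
exact: dvdn_trans Q4.
Qed.

(** An odd power of Q is 3 mod 4, so k must be even; the maximum with 1 records this. For k = 2l the
    previous criterion applies to Q^2 = 1 mod 4. *)
Lemma dvdn_expn_sub1_two_neg (Q a k : nat) : Q = 3 %[mod 4] -> 1 < a ->
  (2 ^ a %| Q ^ k - 1) = (2 ^ maxn (a - logn 2 (Q + 1)) 1 %| k).
Proof.
move=> Q4 a1; have Q1 : 2 < Q by move: Q4; case: Q => [|[|[]]].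
have [/dvdnP[l ->]|k_odd] := boolP (2 %| k); last first.
  have two_dvd : 2 %| 2 ^ maxn (a - logn 2 (Q + 1)) 1.
    by rewrite dvdn_exp // leq_max orbT.
  rewrite [RHS](contraNF _ k_odd); last exact: dvdn_trans.
  apply/negP => d; have : 4 %| Q ^ k - 1.
    by apply: dvdn_trans d; rewrite (@dvdn_exp2l 2 2).
  rewrite -eqn_mod_dvd ?expn_gt0 ?(ltn_trans _ Q1) //.
  move: k_odd; rewrite dvdn2 negbK -{2}[k]odd_double_half => ->.
  rewrite add1n expnS -mul2n expnM.
  have Q21 : Q ^ 2 = 1 %[mod 4] by rewrite -modnXm Q4.
  by rewrite -modnMmr -modnXm Q21 modnXm exp1n modnMmr muln1 Q4.
rewrite mulnC expnM dvdn_expn_sub1_two; last 2 first.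
- by rewrite -(exp1n 2) ltn_exp2r // ltnW.
- by rewrite -eqn_mod_dvd ?expn_gt0 ?(ltn_trans _ Q1) // -modnXm Q4.
have -> : Q ^ 2 - 1 = (Q - 1) * (Q + 1) by rewrite -(subn_sqr Q 1).
rewrite lognM ?subn_gt0 ?(ltnW Q1) ?addn1 //.
have -> : logn 2 (Q - 1) = 1.
  have Q10 : 0 < Q - 1 by rewrite subn_gt0 ltnW.
  apply/eqP; rewrite eqn_leq -ltnS ltnNge -!pfactor_dvdn //; lia.
have -> : maxn (a - logn 2 Q.+1) 1 = (a - (1 + logn 2 Q.+1)).+1 by lia.
by rewrite expnS dvdn_pmul2l.
Qed.

(** * Multiplicative orders and the size of a coset *)

Lemma ordmod_dvdn (N q j : nat) : 0 < N -> 0 < q -> coprime N q ->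
  (ordmod N q %| j) = (N %| q ^ j - 1).
Proof.
move=> N0 q0 cNq; rewrite /ordmod order_dvdn.
have [N1|N1] := ltnP 1 N; last first.
  have -> : N = 1 by apply/eqP; rewrite eqn_leq N1 N0.
  rewrite dvd1n; apply/eqP/val_inj.
  case: (_ ^+ j)%g => x /=.
  have [->|x0] := eqVneq x 0%R; first by rewrite unitr0.
  by case: x x0 => [[|[|x]]] // ltx _ _; apply/val_inj.
(* Coprimality makes q a unit, so the default value of [insubd] does not occur. *)
rewrite -val_eqE FinRing.val_unitX insubdK /= -?pmulrn; last first.
  by rewrite -topredE /= unitZpE.
rewrite -natrX -eqn_mod_dvd ?expn_gt0 ?q0 //.
by rewrite -!val_Zp_nat // -val_eqE.
Qed.

(** Pairwise coprimality turns the product into an lcm. The induction runs over a list without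
    repetitions because coprimality is known for distinct indices only. *)
Lemma prod_dvdnP (I : finType) (F : I -> nat) (m : nat) :
  (forall i j, i != j -> coprime (F i) (F j)) ->
  reflect (forall i, F i %| m) (\prod_i F i %| m).
Proof.
move=> coF; suff -> : \prod_i F i = \big[lcmn/1]_i F i.
  by apply: (iffP (dvdn_biglcmP _ _ _)) => H i; last move=> _; apply: H.
have: uniq (index_enum I) by apply: index_enum_uniq.
elim: (index_enum I) => [|i r IH] /=; first by rewrite !big_nil.
move=> /andP[ir ur]; rewrite !big_cons -IH // /lcmn.
suff /eqP-> : coprime (F i) (\prod_(j <- r) F j) by rewrite divn1.
elim: r ir {ur IH} => [|j r IH]; first by rewrite big_nil coprimen1.
rewrite inE negb_or big_cons coprimeMr => /andP[ij ir].
by rewrite coF // IH.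
Qed.

(** Since q is invertible modulo N, the sequence g q^j mod N is purely periodic with exact period T,
    and its first T terms are distinct and exhaust the coset. *)
Lemma card_cyclotomic_coset (N q T : nat) (g : int) :
  0 < N -> 0 < q -> coprime N q -> 0 < T ->
  (forall j : nat, (N%:Z %| g * (q ^ j - 1)%:Z)%Z%R = (T %| j)) ->
  #|cyclotomic_coset N q g| = T.
Proof.
move=> N0 q0 cNq T0 period.
have N0z : (N%:Z != 0)%R by rewrite eqz_nat -lt0n.
pose f (j : nat) := (g * q%:Z ^+ j %% N)%Z%R.
have fE j l : (f (l + j) == f l) = (T %| j).
  rewrite /f eqz_mod_dvd -period.
  have -> : (g * q%:Z ^+ (l + j) - g * q%:Z ^+ l
             = q%:Z ^+ l * (g * (q ^ j - 1)%:Z))%R.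
    rewrite -subzn ?expn_gt0 ?q0 // -!natz natrX exprD natz; ring.
  rewrite (@Gauss_dvdzr _ (q%:Z ^+ l)%R) // coprimezE abszX /=.
  exact: coprimeXr.
have f_lt j : `|f j| < N.
  by rewrite -ltz_nat gez0_abs ?modz_ge0 // ltz_pmod.
have fP j : (`|f j|%:Z = f j)%R by rewrite gez0_abs ?modz_ge0.
pose h (j : 'I_T) := Ordinal (f_lt j).
have inj_h : injective h.
  suff le_inj (a b : 'I_T) : a <= b -> h a = h b -> a = b.
    move=> a b hab; have [ab|/ltnW ba] := leqP a b; first exact: le_inj.
    by apply/esym/le_inj.
  move=> ab [] /(congr1 Posz); rewrite !fP => /esym/eqP.
  rewrite -{1}(subnKC ab) fE => d; apply/val_inj => /=.
  apply/eqP; rewrite eqn_leq ab /= -subn_eq0; apply/negPn/negP.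
  by rewrite -lt0n => /dvdn_leq /(_ d); have := ltn_ord b; lia.
rewrite -[RHS]card_ord -(card_imset _ inj_h); apply: eq_card => x.
rewrite !inE; apply/asboolP/imsetP => [[j xE]|[j _ ->]]; last first.
  by exists j; rewrite /= fP.
exists (Ordinal (ltn_pmod j T0)) => //; apply/val_inj => /=.
have : (f j == f (j %% T)).
  by rewrite {1}(divn_eq j T) addnC fE dvdn_mull.
by rewrite /f -xE => /eqP <-.
Qed.

(** * Exact prime powers dividing [mu] *)

(** Modulo p^e, m is p^y times a unit, so z must supply the missing p^(e-y). This serves at 2 and at
    each [p i]. *)
Lemma dvdz_exact_power (p e y : nat) (m c z : int) : 0 < p -> y <= e ->
  coprimez p c -> ((p ^ e)%N%:Z %| m - (p ^ y)%N%:Z * c)%Z%R ->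
  ((p ^ e)%N%:Z %| m * z)%Z%R = ((p ^ (e - y))%N%:Z %| z)%Z.
Proof.
move=> p0 ye cpc d.
have -> : (m * z = (m - (p ^ y)%N%:Z * c) * z + (p ^ y)%N%:Z * (c * z))%R.
  by ring.
rewrite rpredDl ?(dvdz_mulr _ d) //.
rewrite -{1}(subnKC ye) expnD PoszM dvdz_mul2l; last first.
  by rewrite eqz_nat -lt0n expn_gt0 p0.
by rewrite Gauss_dvdzr // coprimezE /= coprimeXl.
Qed.

(** For odd [n'] an expansion exists, so [xget] does not return its default. *)
Lemma phi_bitsP (n' : nat) (g : int) :
  odd n' -> two_adic_expansion n' g (phi_bits n' g).
Proof.
move=> on; have [b [bP _]] := two_adic_expansion_exists_unique g on.
by apply: xgetPex; exists b.
Qed.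

(** With the true digits up to d the value is divisible by 2^(d+1); flipping digit d changes it by
    an odd multiple of 2^d. The free [w] stands for the higher bits coming from t. *)
Lemma two_adic_val_Ubits (n' d w : nat) (g : int) : odd n' ->
  exists2 c : int, odd `|c| &
    (g + n'%:Z * (Ubits n' g d + 2 ^ d.+1 * w)%N%:Z = (2 ^ d)%N%:Z * c)%R.
Proof.
move=> on; have /dvdzP[m] := phi_bitsP g on d.
rewrite big_ord_recr /Ubits /=; set S := \sum_(i < d) _.
set b := phi_bits _ _ _.
have -> : (2 ^+ d.+1 = 2 * (2 ^ d)%N%:Z :> int)%R by rewrite exprS -!natz natrX.
rewrite expnS; set P := 2 ^ d => gE.
(* The factor 1 - 2b is the flipped digit 1 - b minus the true digit b. *)
exists (2 * m + n'%:Z * (1 - 2 * b%:Z) + 2 * n'%:Z * w%:Z)%R.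
  by case: b {gE}; lia.
have -> : (g = m * (2 * P%:Z) - n'%:Z * (S + b * P)%N%:Z)%R.
  by rewrite -gE; ring.
by case: (b); rewrite /= ?subnn ?subn0 ?mul1n ?mul0n ?addn0 ?PoszD ?PoszM; ring.
Qed.

(** * Comparison of [tau] and [omega] *)

Lemma prime_powers_coprime (s : nat) (p a : 'I_s -> nat) (i j : 'I_s) :
  (forall i, prime (p i)) -> injective p -> i != j ->
  coprime (p i ^ a i) (p j ^ a j).
Proof.
move=> pp pI ij; apply/coprimeXl/coprimeXr.
by rewrite prime_coprime // dvdn_prime2 // (inj_eq pI).
Qed.

Lemma biglcm_ordmod_dvdnP (s q : nat) (p a : 'I_s -> nat) (j : nat) :
  (forall i, prime (p i)) -> 0 < q -> (forall i, coprime (p i) q) ->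
  reflect (forall i, p i ^ a i %| q ^ j - 1)
          (\big[lcmn/1]_(i < s) ordmod (p i ^ a i) q %| j).
Proof.
move=> pp q0 cpq.
have ordP i : (ordmod (p i ^ a i) q %| j) = (p i ^ a i %| q ^ j - 1).
  by rewrite ordmod_dvdn ?expn_gt0 ?(prime_gt0 (pp _)) ?coprimeXl.
by apply: (iffP (dvdn_biglcmP _ _ _)) => H i *;
  [rewrite -ordP|rewrite ordP]; apply: H.
Qed.

Definition tau_dvdnP s q p e y j :=
  @biglcm_ordmod_dvdnP s q p (fun i => e i - y i) j.

Definition omega_dvdnP s q p e y j :=
  @biglcm_ordmod_dvdnP s q p (fun i => minn (e i - y i) 1) j.

Lemma biglcmn_gt0 (I : finType) (F : I -> nat) :
  (forall i, 0 < F i) -> 0 < \big[lcmn/1]_i F i.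
Proof.
by move=> F0; elim/big_ind: _ => // m n m0 n0; rewrite lcmn_gt0 m0.
Qed.

Lemma tauE (s q : nat) (p e y : 'I_s -> nat) :
  (forall i, prime (p i)) -> (forall i, odd (p i)) -> injective p ->
  1 < q -> (forall i, coprime (p i) q) ->
  tau q p e y = omega q p e y * \prod_(i < s) p i ^ Mexp q p e y i.
Proof.
move=> pp po pI q1 cpq; have q0 := ltnW q1.
set w := omega q p e y.
have w0 : 0 < w by apply: biglcmn_gt0 => i; apply: order_gt0.
have Q1 : 1 < q ^ w by rewrite -(exp1n w) ltn_exp2r.
have wP := elimT (omega_dvdnP e y w pp q0 cpq) (dvdnn _).
have loc i k :
    (p i ^ (e i - y i) %| q ^ (w * k) - 1) = (p i ^ Mexp q p e y i %| k).
  (* If e_i - y_i = 0, both prime powers are 1; otherwise p_i divides q^w - 1 and the exponent can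
     be lifted. *)
  rewrite expnM /Mexp; have := wP i; case: (e i - y i) => [|a].
    by rewrite sub0n !expn0 !dvd1n.
  by rewrite minnSS minn0 expn1 => pQ; rewrite dvdn_expn_sub1_odd.
have coM i j : i != j -> coprime (p i ^ Mexp q p e y i) (p j ^ Mexp q p e y j).
  exact: prime_powers_coprime.
have tau_mul k :
    (tau q p e y %| w * k) = (\prod_(i < s) p i ^ Mexp q p e y i %| k).
  by apply/(tau_dvdnP e y _ pp q0 cpq)/(prod_dvdnP _ coM) => H i;
    have := H i; rewrite loc.
(* Taking k to be the product in [tau_mul] gives one divisibility; taking k = tau / w gives the
   other. *)
apply/eqP; rewrite eqn_dvd tau_mul dvdnn /=.
have /dvdnP[k tE] : w %| tau q p e y.
  apply/(omega_dvdnP e y _ pp q0 cpq) => i.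
  apply: dvdn_trans (elimT (tau_dvdnP e y _ pp q0 cpq) (dvdnn _) i).
  by rewrite dvdn_exp2l ?geq_minl.
by rewrite tE [k * w]mulnC dvdn_pmul2l // -tau_mul mulnC -tE.
Qed.

(** * The period of the coset of [mu] *)

(** For i = j a primitive root modulo p_i is a unit; otherwise eta_j = 1 modulo p_i, as e_i > 0. *)
Lemma primitive_root_system_coprime (s : nat) (p e : 'I_s -> nat)
    (eta : 'I_s -> int) (i j : 'I_s) :
  (forall i, 0 < e i) -> primitive_root_system p e eta ->
  coprimez (p i) (eta j).
Proof.
move=> e_gt0 prs; have [<-|ij] := eqVneq i j.
  by have [/(_ 1%N isT)[]] := prs i; rewrite expn1 coprimez_sym.
have [_ /(_ i ij)/eqP] := prs j; rewrite eqz_mod_dvd => /dvdzP[c cE].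
have -> : eta j = (c * (p i ^ (e i).-1)%N%:Z * p i + 1)%R.
  by rewrite -mulrA -PoszM -expnSr prednK // -cE subrK.
by rewrite /coprimez gcdzMDl gcdz1.
Qed.

Lemma eta_yx_local (s : nat) (p e : 'I_s -> nat) (eta : 'I_s -> int)
    (y x : 'I_s -> nat) (i : 'I_s) :
  (forall i, prime (p i)) -> injective p ->
  (forall i, 0 < e i) -> primitive_root_system p e eta ->
  exists2 c : int, coprimez (p i) c &
    eta_yx p eta y x = ((p i ^ y i)%N%:Z * c)%R.
Proof.
move=> pp pI e_gt0 prs.
exists ((\prod_(j < s) eta j ^+ x j) *
        \prod_(j < s | j != i) (p j)%:Z ^+ y j)%R.
  rewrite coprimezMr; apply/andP; split.
    elim/big_ind: _ => [|a b ca cb|j _]; first by rewrite coprimezE coprimen1.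
      by rewrite coprimezMr ca.
    by apply: coprimezXr; apply: primitive_root_system_coprime prs.
  elim/big_ind: _ => [|a b ca cb|j ji]; first by rewrite coprimezE coprimen1.
    by rewrite coprimezMr ca.
  apply: coprimezXr; rewrite coprimezE /= prime_coprime // dvdn_prime2 //.
  by rewrite (inj_eq pI) eq_sym.
rewrite /eta_yx [X in (_ * X)%R](bigD1 i) //= mulrCA; congr (_ * _)%R.
by rewrite -!natz natrX.
Qed.

(** Divisibility by n splits into its prime powers. At p_i the multiple of n' vanishes and only
    eta^(y,x) counts; at 2 the exact power is 2^d. Leaving [w] free covers both signs. *)
Lemma mu_period (q e0 s : nat) (p e : 'I_s -> nat) (eta : 'I_s -> int)
    (y x : 'I_s -> nat) (d w j : nat) :
  (forall i, prime (p i)) -> (forall i, odd (p i)) -> injective p ->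
  (forall i, 0 < e i) -> primitive_root_system p e eta ->
  0 < q -> (forall i, coprime (p i) q) -> (forall i, y i <= e i) -> d <= e0 ->
  ((2 ^ e0 * \prod_(i < s) p i ^ e i)%N%:Z %|
     (eta_yx p eta y x + (oddpart p e)%:Z *
        (Ubits (oddpart p e) (eta_yx p eta y x) d + 2 ^ d.+1 * w)%N%:Z)
     * (q ^ j - 1)%N%:Z)%Z%R
  = (tau q p e y %| j) && (2 ^ (e0 - d) %| q ^ j - 1).
Proof.
move=> pp po pI e_gt0 prs q0 cpq ye de.
have odd_n' : odd (oddpart p e).
  rewrite /oddpart; elim/big_ind: _ => // [a b|i _]; last first.
    by rewrite oddX po orbT.
  by rewrite oddM => -> ->.
have [c oc cE] := two_adic_val_Ubits d w (eta_yx p eta y x) odd_n'.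
set u := (Ubits _ _ _ + _)%N in cE *; set mu := (_ + _)%R in cE *.
have two : ((2 ^ e0)%N%:Z %| mu * (q ^ j - 1)%N%:Z)%Z%R
           = (2 ^ (e0 - d) %| q ^ j - 1).
  apply: (@dvdz_exact_power _ _ _ _ c); rewrite ?cE ?subrr ?dvdz0 //.
  by rewrite coprimezE coprime2n.
have loc i : ((p i ^ e i)%N%:Z %| mu * (q ^ j - 1)%N%:Z)%Z%R
             = (p i ^ (e i - y i) %| q ^ j - 1).
  have [c' cc gE] := eta_yx_local y x i pp pI e_gt0 prs.
  apply: (@dvdz_exact_power _ _ _ _ c'); rewrite ?prime_gt0 //.
  rewrite -gE /mu addrC addKr dvdz_mulr // dvdzE /= /oddpart.
  by rewrite (bigD1 i) //= dvdn_mulr.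
have coM i l : i != l -> coprime (p i ^ e i) (p l ^ e l).
  exact: prime_powers_coprime.
rewrite dvdzE /= Gauss_dvd; last by apply: coprimeXl; rewrite coprime2n.
rewrite andbC; congr andb; last by rewrite -two dvdzE.
by apply/(prod_dvdnP _ coM)/(tau_dvdnP e y _ pp q0 cpq) => H i;
  have := H i; rewrite -loc dvdzE.
Qed.

Theorem corollary3p4 (p0 k q e0 s : nat) (p e : 'I_s -> nat) (eta : 'I_s -> int)
  (p0_prime : prime p0) (p0_odd : odd p0) (k_gt0 : 0 < k) (qE : q = p0 ^ k)
  (p_prime : forall i, prime (p i)) (p_odd : forall i, odd (p i))
  (p_neq : forall i, p i != p0) (p_inj : injective p)
  (e0_gt0 : 0 < e0) (e_gt0 : forall i, 0 < e i)
  (eta_prs : primitive_root_system p e eta) :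
  let n := 2 ^ e0 * \prod_(i < s) p i ^ e i in
  (forall y x : 'I_s -> nat, Sigma_plus q p e y x ->
     forall d : nat, d <= e0 ->
     forall t : (s_plus q p e e0 y d).-tuple bool,
       #|cyclotomic_coset n q (mu_plus eta x t)|
         = 2 ^ (e0 - d - v_plus q p e y)
           * (omega q p e y * \prod_(i < s) p i ^ Mexp q p e y i)) /\
  (forall y x : 'I_s -> nat, Sigma_minus q p e y x ->
     forall d : nat, d <= e0 ->
     forall t : (s_minus q p e e0 y d).-tuple bool,
       (d + 2 <= e0 ->
          #|cyclotomic_coset n q (mu_minus eta x t)|
            = 2 ^ maxn (e0 - d - v_minus q p e y) 1
              * (omega q p e y * \prod_(i < s) p i ^ Mexp q p e y i)) /\
       (d = e0 - 1 \/ d = e0 ->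
          #|cyclotomic_coset n q (mu_minus eta x t)|
            = omega q p e y * \prod_(i < s) p i ^ Mexp q p e y i)).
Proof.
move=> n.
have q_odd : odd q by rewrite qE oddX p0_odd orbT.
have q1 : 1 < q by rewrite qE -(exp1n k) ltn_exp2r // prime_gt1.
have q0 := ltnW q1.
have cpq i : coprime (p i) q.
  by rewrite qE coprimeXr // prime_coprime // dvdn_prime2.
have n0 : 0 < n.
  by rewrite muln_gt0 expn_gt0 prodn_gt0 // => i; rewrite expn_gt0 prime_gt0.
have cnq : coprime n q.
  rewrite coprimeMl coprimeXl ?coprime2n //=.
  by elim/big_ind: _ => [|a b ca cb|i _];
    rewrite ?coprime1n ?coprimeMl ?ca ?coprimeXl.
(* Common to both signs: K is the order of q^tau modulo 2^(e0-d), so the period is K tau. *)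
have card_mu (y x : 'I_s -> nat) (d w K : nat) : (forall i, y i <= e i) ->
    d <= e0 -> 0 < K ->
    (forall j, (2 ^ (e0 - d) %| (q ^ tau q p e y) ^ j - 1) = (K %| j)) ->
    #|cyclotomic_coset n q (eta_yx p eta y x + (oddpart p e)%:Z *
        (Ubits (oddpart p e) (eta_yx p eta y x) d + 2 ^ d.+1 * w)%N%:Z)%R|
    = K * (omega q p e y * \prod_(i < s) p i ^ Mexp q p e y i).
  move=> ye de K0 KP; rewrite -tauE //.
  have tau0 : 0 < tau q p e y by apply: biglcmn_gt0 => i; apply: order_gt0.
  apply: card_cyclotomic_coset => // [|j]; first by rewrite muln_gt0 K0.
  rewrite mu_period //; apply/andP/idP => [[/dvdnP[l ->]]|/dvdnP[l ->]].
    by rewrite dvdn_pmul2r // -KP -expnM [tau _ _ _ _ * _]mulnC.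
  by rewrite mulnA dvdn_mull // mulnC expnM KP dvdn_mull.
split=> y x [Sg tauP] d de t; have ye i : y i <= e i by case: (Sg i).
  have Q1 : 1 < q ^ tau q p e y.
    rewrite -(exp1n (tau q p e y)) ltn_exp2r //.
    by apply: biglcmn_gt0 => i; apply: order_gt0.
  rewrite /mu_plus; set W := \sum_(j < _) _.
  (* The bits of t sit strictly above position d, so they form a multiple of 2^(d+1). *)
  have -> : W = 2 ^ d.+1 * \sum_(j < s_plus q p e e0 y d) tnth t j * 2 ^ j.
    rewrite /W big_distrr /=; apply: eq_bigr => j _.
    by rewrite mulnCA -expnD addSnnS.
  apply: card_mu => // [|j]; first by rewrite expn_gt0.
  by rewrite dvdn_expn_sub1_two // -eqn_mod_dvd ?(ltnW Q1) // tauP.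
rewrite /mu_minus; set W := \sum_(j < _) _.
have -> : W = 2 ^ d.+1 * \sum_(j < s_minus q p e e0 y d) tnth t j * 2 ^ j.+1.
  rewrite /W big_distrr /=; apply: eq_bigr => j _.
  by rewrite mulnCA -expnD; congr (_ * 2 ^ _); lia.
split=> dE.
  apply: card_mu => // [|j]; first by rewrite expn_gt0.
  by apply: dvdn_expn_sub1_two_neg; lia.
(* Here e0 - d is at most 1 and q is odd, so the condition at 2 always holds and K = 1. *)
rewrite -[RHS]mul1n; apply: card_mu => // j; rewrite dvd1n.
have /dvdn_trans->// : 2 ^ (e0 - d) %| 2 ^ 1 by apply: dvdn_exp2l; lia.
by rewrite expn1 dvdn2 oddB ?expn_gt0 ?q0 // !oddX q_odd !orbT.
Qed.
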